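(* Let $b \ge 1$ and $w \ge 1$ be integers, and let $T_{b,w}$ be the number of draws until a black ball is first selected in the urn process that starts with $b$ black and $w$ white balls and in which, after each draw of a white ball, that ball is returned to the urn together with one additional white ball. Then for every integer $r$, $$\mathbb{E}\big[T_{b,w}^{\,r}\big] < \infty \iff b > r,$$ regardless of the value of $w$. In particular, $\mathbb{E}[T_{b,w}]$ is finite if and only if $b \ge 2$, and the variance of $T_{b,w}$ is finite if and only if $b \ge 3$.
   Context: Urn process: an urn initially contains $b$ black and $w$ white balls. At each time $k=1,2,3,\ldots$ a ball is selected uniformly at random from the urn (given the current composition). If it is black, the process stops. If it is white, it is returned to the urn together with one further white ball, and the process continues. $T_{b,w}\in\{1,2,3,\ldots\}\cup\{\infty\}$ denotes the number of draws up to and including the first draw of a black ball ($T_{b,w}=\infty$ if no black ball is ever drawn). Thus $\{T_{b,w}>n\}$ is the event that the first $n$ draws are all white. Conventions: $\infty^r=\infty$ for $r\ge 1$, $\infty^0=1$, and $\infty^r=0$ for $r\le -1$. ''The variance of $T_{b,w}$ is finite'' means that $\mathbb{E}[T_{b,w}^2]<\infty$. *)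

(* Defs.v *)
(* MathComp-Analysis *)
From HB Require Import structures.
From mathcomp Require Import all_boot all_order all_algebra.
From mathcomp Require Import all_classical all_reals all_analysis.
Set Implicit Arguments.
Unset Strict Implicit.
Unset Printing Implicit Defensive.
Import Order.TTheory GRing.Theory Num.Theory.
Local Open Scope classical_set_scope.
Local Open Scope ring_scope.

Inductive color := Black | White.

Record urn := Urn { nblack : nat; nwhite : nat }.

Definition balls (u : urn) (c : color) : nat :=
  match c with Black => nblack u | White => nwhite u end.

(* [None] means that the process has stopped. *)
Definition urn_after (u : urn) (c : color) : option urn :=
  match c with
  | Black => None
  | White => Some (Urn (nblack u) (nwhite u).+1)
  end.

(* The sequence [c] records the draws: [c k] is the colour drawn at time
   [k.+1], or [None] if no draw takes place at that time. [urn_state u0 c n]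
   is the state of the urn after the first [n] draws, i.e. just before the
   draw at time [n.+1]. *)
Fixpoint urn_state (u0 : urn) (c : nat -> option color) (n : nat)
    : option urn :=
  match n with
  | 0%N => Some u0
  | m.+1 => match urn_state u0 c m, c m with
            | Some u, Some x => urn_after u x
            | _, _ => None
            end
  end.

Definition draw_prob (R : realType) (s : option urn) (x : option color) : R :=
  match s, x with
  | Some u, Some y => (balls u y)%:R / (nblack u + nwhite u)%:R
  | None, None => 1
  | _, _ => 0
  end.

(* [X k] is the outcome at time [k.+1]. The conditional law of each outcome
   given the past is stated in product form, so that no conditioning on null
   events is needed. *)
Record is_urn_process (R : realType) (d : measure_display)
    (Omega : measurableType d) (P : probability Omega R) (b w : nat)
    (X : nat -> Omega -> option color) : Prop := IsUrnProcess {
  urn_process_measurable :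
    forall k (x : option color), measurable [set om | X k om = x];
  urn_process_law :
    forall n (c : nat -> option color),
      P [set om | forall k, (k < n.+1)%N -> X k om = c k] =
      (P [set om | forall k, (k < n)%N -> X k om = c k] *
       (draw_prob R (urn_state (Urn b w) c n) (c n))%:E)%E
}.

(* The infimum of the empty set is [+oo]. *)
Definition first_black (R : realType) (Omega : Type)
    (X : nat -> Omega -> option color) (om : Omega) : \bar R :=
  ereal_inf [set (k.+1)%:R%:E | k in [set k | X k om = Some Black]].

(* Integer powers with the conventions [+oo ^ r = +oo] for [r >= 1],
   [+oo ^ 0 = 1] and [+oo ^ r = 0] for [r <= -1]; these differ from the
   library's [poweR] for negative exponents. The value at [-oo] is irrelevant,
   as only elements of [1, +oo] are raised to a power. *)
Definition epowz (R : realType) (x : \bar R) (r : int) : \bar R :=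
  match x with
  | y%:E => (y ^ r)%:E
  | +oo%E => if 0 < r then +oo%E else if r == 0 then 1%E else 0%E
  | -oo%E => 0%E
  end.

(* Main.v *)
(** The probability that the first [n] draws are white is
    [\prod_(k < n) (w + k) / (b + w + k)]; cancelling, it is a constant over
    the rising factorial [(w + n) ... (w + n + b - 1)], so that [P (T = n + 1)]
    is a constant over a rising factorial of length [b + 1] and is squeezed
    between two multiples of [(n + 1) ^ - (b + 1)]. The mass of [T] telescopes
    to [1], so the event [T = +oo] is null and
    [E (T ^ r) = \sum_n (n + 1) ^ r P (T = n + 1)], which is compared with
    [\sum_n 1 / (n + 1) ^ 2] when [r < b] and with the harmonic series when
    [b <= r]. *)
Require Import Defs.
From HB Require Import structures.
From mathcomp Require Import all_boot all_order all_algebra.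
From mathcomp Require Import all_classical all_reals all_analysis.
From mathcomp Require Import measurable_realfun ring lra zify.
Set Implicit Arguments.
Unset Strict Implicit.
Unset Printing Implicit Defensive.
Import Order.TTheory GRing.Theory Num.Theory.
Local Open Scope classical_set_scope.
Local Open Scope ring_scope.

(** * Rising factorials and the probabilities built from them *)

Definition rising (R : realType) (b m : nat) : R :=
  \prod_(j < b) (m + j)%:R.

Lemma rising_gt0 (R : realType) (b m : nat) : (0 < m)%N -> 0 < rising R b m.
Proof. by move=> m0; apply: prodr_gt0 => j _; rewrite ltr0n addn_gt0 m0. Qed.

Lemma risingSr (R : realType) (b m : nat) :
  rising R b.+1 m = rising R b m * (m + b)%:R.
Proof. by rewrite /rising big_ord_recr. Qed.

Lemma risingSl (R : realType) (b m : nat) :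
  rising R b.+1 m = m%:R * rising R b m.+1.
Proof.
rewrite /rising big_ord_recl addn0; congr (_ * _).
by apply: eq_bigr => i _; rewrite lift0 addnS.
Qed.

Lemma rising_lower (R : realType) (b w n : nat) : (0 < w)%N ->
  (n.+1)%:R ^+ b <= rising R b (w + n).
Proof.
move=> w0; rewrite /rising -[b in _ ^+ b](card_ord b) -prodr_const.
by apply: ler_prod => i _; rewrite ler0n ler_nat -add1n -addnA leq_add ?leq_addr.
Qed.

(** Each factor [w + n + j] with [j < b] is at most [(w + b) * (n + 1)]; a crude constant is enough,
    since only the order of growth in [n] matters. *)
Lemma rising_upper (R : realType) (b w n : nat) :
  rising R b (w + n) <= ((w + b)%:R * (n.+1)%:R) ^+ b.
Proof.
rewrite /rising -[b in _ ^+ b](card_ord b) -prodr_const.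
apply: ler_prod => i _; rewrite ler0n -natrM ler_nat /=.
have := ltn_ord i; nia.
Qed.

(* The probability that the first [n] draws are white: the product
   [\prod_(k < n) (w + k) / (b + w + k)] after cancellation. *)
Definition white_prob (R : realType) (b w n : nat) : R :=
  rising R b w / rising R b (w + n).

Definition black_prob (R : realType) (b w n : nat) : R :=
  white_prob R b w n * (b%:R / (b + (w + n))%:R).

Lemma white_prob0 (R : realType) (b w : nat) : (0 < w)%N ->
  white_prob R b w 0 = 1.
Proof. by move=> w0; rewrite /white_prob addn0 divff ?gt_eqF ?rising_gt0. Qed.

(** Splitting off the first or the last factor of the rising factorial of length [b + 1] at [w + n]
    gives two expressions for it; comparing them yields the ratio. *)
Lemma white_probS (R : realType) (b w n : nat) : (0 < w)%N ->
  white_prob R b w n.+1 =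
  white_prob R b w n * ((w + n)%:R / (b + (w + n))%:R).
Proof.
move=> w0; rewrite /white_prob -mulrA addnS; congr (_ * _).
have m0 : (0 < w + n)%N by rewrite addn_gt0 w0.
have := risingSl R b (w + n); rewrite risingSr [(w + n + b)%N]addnC => e.
have s0 : (b + (w + n))%:R != 0 :> R by rewrite pnatr_eq0 -lt0n addn_gt0 m0 orbT.
have m0' : (w + n)%:R != 0 :> R by rewrite pnatr_eq0 -lt0n.
have r1 : rising R b (w + n).+1 != 0 by rewrite gt_eqF// rising_gt0.
rewrite -[rising R b (w + n)](mulfK s0) e.
by field; rewrite -!natrD s0 m0' r1.
Qed.

Lemma black_probE (R : realType) (b w n : nat) : (0 < w)%N ->
  black_prob R b w n = white_prob R b w n - white_prob R b w n.+1.
Proof.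
move=> w0; rewrite white_probS// /black_prob -[X in _ = X - _]mulr1 -mulrBr.
congr (_ * _); have s0 : (b + (w + n))%:R != 0 :> R.
  by rewrite pnatr_eq0 -lt0n !addn_gt0 w0 orbT.
by field; rewrite -!natrD.
Qed.

(** The denominator of the final draw, [b + (w + n)], lengthens the rising factorial by one factor;
    this turns decay of order [b] into order [b + 1]. *)
Lemma black_prob_rising (R : realType) (b w n : nat) :
  black_prob R b w n = rising R b w * b%:R / rising R b.+1 (w + n).
Proof.
rewrite /black_prob /white_prob risingSr invfM [(b + _)%N]addnC.
by rewrite -!mulrA; congr (_ * _); rewrite mulrCA.
Qed.

Lemma black_prob_ge0 (R : realType) (b w n : nat) : 0 <= black_prob R b w n.
Proof.
by rewrite !(mulr_ge0, invr_ge0)//; apply: prodr_ge0.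
Qed.

Lemma black_prob_upper (R : realType) (b w n : nat) : (0 < w)%N ->
  black_prob R b w n <= rising R b w * b%:R * (n.+1%:R ^+ b.+1)^-1.
Proof.
move=> w0; rewrite black_prob_rising ler_wpM2l ?mulr_ge0 ?(ltW (rising_gt0 _ _ w0))//.
by rewrite lef_pV2 ?posrE ?exprn_gt0 ?rising_gt0 ?addn_gt0 ?w0// rising_lower.
Qed.

Lemma black_prob_lower (R : realType) (b w n : nat) : (0 < w)%N ->
  rising R b w * b%:R / (w + b.+1)%:R ^+ b.+1 * (n.+1%:R ^+ b.+1)^-1
  <= black_prob R b w n.
Proof.
move=> w0; rewrite black_prob_rising -mulrA -invfM -exprMn.
rewrite ler_wpM2l ?mulr_ge0 ?(ltW (rising_gt0 _ _ w0))//.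
by rewrite lef_pV2 ?posrE ?rising_gt0 ?addn_gt0 ?w0 ?rising_upper.
Qed.

(** As [b >= 1], the denominator is at least [(n + 1) ^ b >= n + 1], so a multiple of the harmonic
    sequence dominates. *)
Lemma white_prob_cvg0 (R : realType) (b w : nat) : (0 < b)%N -> (0 < w)%N ->
  white_prob R b w @ \oo --> 0.
Proof.
move=> b0 w0; have ub : (fun n => rising R b w * harmonic n) @ \oo --> 0.
  by rewrite -[X in _ --> X](mulr0 (rising R b w)); apply: cvgMr; exact: cvg_harmonic.
apply: squeeze_cvgr ub; [near=> n|exact: (cvg_cst 0)].
have m0 : (0 < w + n)%N by rewrite addn_gt0 w0.
rewrite divr_ge0 ?(ltW (rising_gt0 _ _ _))//= ler_wpM2l ?(ltW (rising_gt0 _ _ w0))//.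
rewrite lef_pV2 ?posrE ?rising_gt0//.
apply: le_trans (rising_lower R b n w0).
by rewrite -[X in X <= _]expr1 ler_weXn2l// ler1n.
Unshelve. all: by end_near. Qed.

(** * Convergence of the moment series *)

Lemma nneseries_le (R : realType) (u : R^nat) (M : R) :
  (forall n, 0 <= u n) -> (forall n, \sum_(0 <= k < n) u k <= M) ->
  (\sum_(0 <= k <oo) (u k)%:E <= M%:E)%E.
Proof.
move=> u0 uM; apply: lime_le.
  by apply: is_cvg_nneseries => n _; rewrite lee_fin.
by near=> n; rewrite sumEFin lee_fin.
Unshelve. all: by end_near. Qed.

Lemma nneseries_inv_sqr_lty (R : realType) :
  (\sum_(0 <= k <oo) ((k.+1%:R ^+ 2)^-1 : R)%:E < +oo)%E.
Proof.
apply: (@le_lt_trans _ _ 2%:E); last exact: ltry.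
apply: nneseries_le => n; first by rewrite invr_ge0 exprn_ge0.
(* The bound 2 is sharpened so that induction applies: [2 / (n + 1) - 2 / (n + 2)] exceeds
   [1 / (n + 1) ^ 2] by [n / ((n + 1) ^ 2 * (n + 2))]. *)
suff : \sum_(0 <= k < n) (k.+1%:R ^+ 2)^-1 <= 2 - 2 / n.+1%:R :> R.
  by move=> /le_trans; apply; rewrite gerBl divr_ge0.
elim: n => [|n IHn]; first by rewrite big_geq// divr1 subrr.
rewrite big_nat_recr//=; apply: le_trans (lerD IHn (lexx _)) _.
rewrite -addrA lerD2l -subr_ge0.
have n0 : 0 <= n%:R :> R by [].
rewrite -[n.+2%:R]natr1 -[n.+1%:R]natr1.
rewrite [leRHS](_ : _ = n%:R / ((n%:R + 1) ^+ 2 * (n%:R + 1 + 1))).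
  by rewrite divr_ge0// mulr_ge0 ?exprn_ge0 ?addr_ge0.
by field; rewrite !gt_eqF//; lra.
Qed.

Lemma nneseries_harmonic (R : realType) :
  (\sum_(0 <= k <oo) (harmonic k : R)%:E = +oo)%E.
Proof.
apply/eqP; rewrite eq_le leey/= leNgt; apply/negP => h.
by apply: (@dvg_harmonic R); apply: nnseries_is_cvg h => n; exact: harmonic_ge0.
Qed.

Lemma nneseries_moment_lty (R : realType) (b w : nat) (r : int) :
  (0 < b)%N -> (0 < w)%N ->
  (\sum_(0 <= n <oo) (n.+1%:R ^ r * black_prob R b w n)%:E < +oo)%E <->
  r < b%:Z.
Proof.
move=> b0 w0.
have powD (n : nat) : n.+1%:R ^ r * (n.+1%:R ^+ b.+1)^-1 =
    n.+1%:R ^ (r - b.+1%:Z) :> R.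
  by rewrite expfzDr ?pnatr_eq0// -exprz_inv -exprnN.
have term_ge0 (n : nat) : 0 <= n.+1%:R ^ r * black_prob R b w n.
  by rewrite mulr_ge0 ?exprz_ge0 ?black_prob_ge0.
set K := rising R b w * b%:R.
have K0 : 0 < K by rewrite mulr_gt0 ?rising_gt0 ?ltr0n.
split=> [|rb].
  apply: contraTT; rewrite -leNgt => br; rewrite -leNgt.
  set L := K / (w + b.+1)%:R ^+ b.+1.
  have L0 : 0 < L by rewrite divr_gt0// exprn_gt0// ltr0n addnS.
  (* Writing [+oo] as a positive multiple of the harmonic series reduces divergence to a termwise
     comparison. *)
  have <- : (L%:E * \sum_(0 <= n <oo) (harmonic n : R)%:E)%E = +oo%E.
    by rewrite nneseries_harmonic gt0_muley// lte_fin.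
  rewrite -nneseriesZl; last by move=> n _; rewrite lee_fin harmonic_ge0.
  apply: lee_nneseries => n *; first by rewrite -EFinM lee_fin mulr_ge0 ?harmonic_ge0 ?ltW.
  rewrite -EFinM lee_fin.
  have := black_prob_lower R b n w0; rewrite -/K -/L => /(ler_wpM2l _) lo.
  apply: le_trans (lo (n.+1%:R ^ r) _); last by rewrite exprz_ge0.
  rewrite mulrCA powD ler_wpM2l ?(ltW L0)//= -[_^-1]exprN1.
  (* From [b <= r], the exponent [r - (b + 1)] is at least [-1]. *)
  rewrite ler_weXz2l ?ler1n//; lia.
apply: (@le_lt_trans _ _ (K%:E * \sum_(0 <= k <oo) ((k.+1%:R ^+ 2)^-1 : R)%:E)%E).
  rewrite -nneseriesZl; last by move=> n _; rewrite lee_fin invr_ge0 exprn_ge0.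
  apply: lee_nneseries => n *; first by rewrite lee_fin.
  rewrite -EFinM lee_fin.
  have := black_prob_upper R b n w0; rewrite -/K => /(ler_wpM2l _) up.
  apply: le_trans (up (n.+1%:R ^ r) _) _; first by rewrite exprz_ge0.
  rewrite mulrCA powD ler_wpM2l ?(ltW K0)//= exprnN.
  (* From [r < b] between integers, the exponent [r - (b + 1)] is at most [-2]. *)
  rewrite ler_weXz2l ?ler1n//; lia.
by rewrite lte_mul_pinfty ?lee_fin ?ltW ?fin_numE//; exact: nneseries_inv_sqr_lty.
Qed.

(** * The time of the first black draw, outcome by outcome *)

Lemma first_black_eq (R : realType) (Omega : Type)
    (X : nat -> Omega -> option color) (om : Omega) (n : nat) :
  X n om = Some Black -> (forall k, (k < n)%N -> X k om <> Some Black) ->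
  first_black R X om = n.+1%:R%:E.
Proof.
move=> Xn Xk; apply/eqP; rewrite eq_le; apply/andP; split.
  by apply: ereal_inf_lbound; exists n.
apply: le_ereal_inf_tmp => _ [k /= Xkb <-]; rewrite lee_fin ler_nat ltnS leqNgt.
by apply/negP => /Xk.
Qed.

Lemma first_black_pinfty (R : realType) (Omega : Type)
    (X : nat -> Omega -> option color) (om : Omega) :
  (forall k, X k om <> Some Black) -> first_black R X om = +oo%E.
Proof.
move=> Xk; rewrite -(ereal_inf0 R); congr ereal_inf.
by rewrite -subset0 => x [k /= /Xk].
Qed.

Lemma first_black_ge1 (R : realType) (Omega : Type)
    (X : nat -> Omega -> option color) (om : Omega) :
  (1 <= first_black R X om)%E.
Proof. by apply: le_ereal_inf_tmp => _ [k _ <-]; rewrite lee_fin ler1n. Qed.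

Lemma epowz_ge0 (R : realType) (x : \bar R) (r : int) :
  (0 <= x)%E -> (0 <= epowz x r)%E.
Proof.
case: x => [x||]//=; first by rewrite !lee_fin => /exprz_ge0.
by move=> _; case: ifP => // _; case: ifP.
Qed.

Lemma epowz1 (R : realType) (x : \bar R) : (0 <= x)%E -> epowz x 1 = x.
Proof. by case: x => [x||]//=; rewrite expr1z. Qed.

(** Earlier draws may also be [None], so that these events and [never_black] cover the whole space
    and not just almost all of it, as measurability requires. *)
Definition first_black_at (Omega : Type) (X : nat -> Omega -> option color)
    (n : nat) : set Omega :=
  [set om | X n om = Some Black] `&`
  \bigcap_(k in `I_n) [set om | X k om <> Some Black].

Definition never_black (Omega : Type) (X : nat -> Omega -> option color)
    : set Omega :=
  \bigcap_k [set om | X k om <> Some Black].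

Lemma first_black_partition (Omega : Type) (X : nat -> Omega -> option color) :
  never_black X `|` \bigcup_n first_black_at X n = setT.
Proof.
rewrite -subTset => om _.
have [[n Xn]|noX] := pselect (exists n, X n om = Some Black).
  right; have h : exists n, `[< X n om = Some Black >] by exists n; apply/asboolP.
  case: (ex_minnP h) => m /asboolP Xm mP; exists m => //; split => // k /= km /asboolP.
  by move=> /mP; rewrite leqNgt km.
by left=> k _ Xk; apply: noX; exists k.
Qed.

(** * Measurability of functions of the first black time *)

Section measurability.
Context (d : measure_display) (Omega : measurableType d).
Variable X : nat -> Omega -> option color.
Hypothesis mX : forall k x, measurable [set om | X k om = x].

Lemma measurable_neq k x : measurable [set om | X k om <> x].
Proof. exact: measurableC (mX k x). Qed.

Lemma measurable_first_black_at n : measurable (first_black_at X n).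
Proof.
(* The empty intersection at [n = 0] is treated apart, because [bigcap_measurable] asks for a
   nonempty index set. *)
apply: measurableI => //; case: n => [|n]; first by rewrite II0 bigcap_set0.
by apply: bigcap_measurable => [|k _]; [exists 0%N|exact: measurable_neq].
Qed.

Lemma measurable_never_black : measurable (never_black X).
Proof. by apply: bigcapT_measurable => k; exact: measurable_neq. Qed.

Lemma measurable_cylinder (c : nat -> option color) n :
  measurable [set om | forall k, (k < n)%N -> X k om = c k].
Proof.
rewrite (_ : [set _ | _] = \bigcap_(k in `I_n) [set om | X k om = c k])//.
case: n => [|n]; first by rewrite II0 bigcap_set0.
by apply: bigcap_measurable => [|k _]; [exists 0%N|exact: mX].
Qed.

(** An arbitrary [g] is allowed: [first_black] is constant on each of countably many measurable
    pieces, hence so is its composite with [g]. *)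
Lemma measurable_fun_first_black (R : realType) (g : \bar R -> \bar R) :
  measurable_fun setT ((fun om => g (first_black R X om)) : Omega -> \bar R).
Proof.
rewrite -(first_black_partition X); apply/measurable_funU.
- exact: measurable_never_black.
- by apply: bigcupT_measurable => n; exact: measurable_first_black_at.
split.
  apply: (eq_measurable_fun (cst (g +oo%E))); last exact: measurable_cst.
  by move=> om /set_mem h; rewrite first_black_pinfty// => k; exact: h.
apply/measurable_fun_bigcup => n; first exact: measurable_first_black_at.
apply: (eq_measurable_fun (cst (g n.+1%:R%:E))); last exact: measurable_cst.
by move=> om /set_mem [Xn h]; rewrite (first_black_eq _ Xn)// => k /h.
Qed.

End measurability.

(** * Law of the draws, and moments as series *)

Lemma urn_state_ext (u : urn) (c c' : nat -> option color) (n : nat) :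
  (forall k, (k < n)%N -> c k = c' k) -> urn_state u c n = urn_state u c' n.
Proof.
elim: n => //= n IHn cc'; rewrite IHn ?cc'// => k kn.
by apply: cc'; exact: ltnW.
Qed.

Lemma urn_state_white (b w n : nat) :
  urn_state (Urn b w) (fun=> Some White) n = Some (Urn b (w + n)).
Proof. by elim: n => /= [|n ->]; rewrite ?addn0 ?addnS. Qed.

(* The draws before time [n.+1] are white, not merely non-black: this makes the
   law of the process directly applicable, and the difference is a null set. *)
Definition black_after_white (Omega : Type) (X : nat -> Omega -> option color)
    (n : nat) : set Omega :=
  [set om | forall k, (k < n.+1)%N ->
    X k om = if (k < n)%N then Some White else Some Black].

Lemma first_black_after_white (R : realType) (Omega : Type)
    (X : nat -> Omega -> option color) (n : nat) (om : Omega) :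
  black_after_white X n om -> first_black R X om = n.+1%:R%:E.
Proof.
move=> h; apply: first_black_eq; first by rewrite h// ltnn.
by move=> k kn; rewrite h ?kn// ltnW.
Qed.

(** The value [n + 1] of [first_black] on the [n]-th event tells the events apart. *)
Lemma trivIset_black_after_white (R : realType) (Omega : Type)
    (X : nat -> Omega -> option color) :
  trivIset setT (black_after_white X).
Proof.
apply/trivIsetP => m n _ _ mn; rewrite -subset0 => om [hm hn].
have := first_black_after_white R hm; rewrite (first_black_after_white R hn).
by move=> [] /eqP; rewrite eqr_nat eqSS eq_sym (negbTE mn).
Qed.

Section law.
Context (R : realType) (d : measure_display) (Omega : measurableType d).
Context (P : probability Omega R) (b w : nat).
Variable X : nat -> Omega -> option color.
Hypotheses (b0 : (0 < b)%N) (w0 : (0 < w)%N) (hX : is_urn_process P b w X).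

Let mX := urn_process_measurable hX.

Lemma prob_all_white n :
  P [set om | forall k, (k < n)%N -> X k om = Some White] =
  (white_prob R b w n)%:E.
Proof.
elim: n => [|n IHn].
  by rewrite white_prob0// -(probability_setT P); congr (P _); apply/seteqP; split.
rewrite (urn_process_law hX n (fun=> Some White)) IHn urn_state_white/=.
by rewrite -EFinM white_probS.
Qed.

Lemma prob_black_after_white n :
  P (black_after_white X n) = (black_prob R b w n)%:E.
Proof.
set c := fun k => if (k < n)%N then Some White else Some Black.
rewrite (urn_process_law hX n c) (@urn_state_ext _ c (fun=> Some White)); last first.
  by move=> k kn; rewrite /c kn.
rewrite urn_state_white /c ltnn/= [RHS]EFinM -prob_all_white; congr (P _ * _)%E.
by apply/seteqP; split => om /= h k kn; rewrite h// kn.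
Qed.

Lemma measurable_black_after_white n : measurable (black_after_white X n).
Proof. exact: (measurable_cylinder mX). Qed.

Let stopped := \bigcup_n black_after_white X n.

Let measurable_stopped : measurable stopped.
Proof. by apply: bigcupT_measurable => n; exact: measurable_black_after_white. Qed.

(** Infinite runs without black and outcomes with a [None] before the first black ball are thereby
    confined to one null set. The partial sums telescope to [1 - white_prob R b w n]. *)
Lemma prob_stopped : P stopped = 1%E.
Proof.
have h := @measure_semi_sigma_additive _ _ _ P _ measurable_black_after_white
  (trivIset_black_after_white R (X := X)) measurable_stopped.
rewrite -(cvg_lim _ h)//; apply/cvg_lim => //.
rewrite (_ : (fun _ => _) = EFin \o (fun n => 1 - white_prob R b w n)).
  apply: cvg_EFin; first by near=> n.
  rewrite -[X in _ --> X]subr0; apply: cvgB; first exact: cvg_cst.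
  exact: white_prob_cvg0.
apply/funext => n /=; under eq_bigr do rewrite prob_black_after_white black_probE//.
rewrite sumEFin; congr EFin; rewrite -(white_prob0 R b w0).
rewrite -opprB -[in RHS]telescope_sumr// -sumrN.
by apply: eq_bigr => k _; rewrite opprB.
Unshelve. all: by end_near. Qed.

Lemma moment_first_black (r : int) :
  (\int[P]_om epowz (first_black R X om) r =
   \sum_(0 <= n <oo) (n.+1%:R ^ r * black_prob R b w n)%:E)%E.
Proof.
have mf := @measurable_fun_first_black _ _ _ mX R (fun x => epowz x r).
have f0 om : (0 <= epowz (first_black R X om) r)%E.
  by apply: epowz_ge0; exact: le_trans (first_black_ge1 R X om).
have PN : P (~` stopped) = 0%E.
  by rewrite probability_setC// prob_stopped subee.
(* Removing the null set leaves the disjoint events [black_after_white X n], on each of which the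
   integrand is the constant [(n + 1) ^ r]. *)
rewrite (@ge0_negligible_integral _ _ _ _ _ (~` stopped))//; first last.
- exact: measurableC.
rewrite setTD setCK ge0_integral_bigcup//; first last.
- exact: trivIset_black_after_white R _ _.
- exact: measurable_funTS.
- exact: measurable_black_after_white.
apply: eq_eseriesr => n _.
rewrite (eq_integral (cst (n.+1%:R ^ r)%:E)) => [|om /set_mem h]; last first.
  by rewrite (first_black_after_white R h).
rewrite integral_cst; last exact: measurable_black_after_white.
by rewrite EFinM; congr (_ * _)%E; exact: prob_black_after_white.
Qed.

End law.

Theorem mainTheorem1 (R : realType) (d : measure_display)
    (Omega : measurableType d) (P : probability Omega R) (b w : nat)
    (X : nat -> Omega -> option color)
    (hb : (1 <= b)%N) (hw : (1 <= w)%N) (hX : is_urn_process P b w X) :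
  [/\ forall r : int,
        (\int[P]_om epowz (first_black R X om) r < +oo)%E <-> r < b%:Z,
      (\int[P]_om first_black R X om < +oo)%E <-> (2 <= b)%N
    & (\int[P]_om epowz (first_black R X om) 2 < +oo)%E <-> (3 <= b)%N].
Proof.
have main (r : int) :
    (\int[P]_om epowz (first_black R X om) r < +oo)%E <-> r < b%:Z.
  by rewrite (moment_first_black hb hw hX); exact: nneseries_moment_lty.
(* For [r = 2], the condition [2 < b] is [3 <= b] by computation. The expectation is the case
   [r = 1], where [epowz] acts as the identity on nonnegative values. *)
split; [exact: main| |exact: main 2].
rewrite -(ltz_nat 1 b) -main.
under [in X in _ <-> X]eq_integral do
  rewrite epowz1 ?(le_trans _ (first_black_ge1 _ _ _))//.
by [].
Qed.
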